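(* For every $\varepsilon>0$ there exists a constant $c_{\varepsilon}>0$ such that every tournament on $n$ vertices contains a square of a path on at least $c_{\varepsilon}n^{1-\varepsilon}$ vertices.
   Context: A tournament is an orientation of a complete graph. A square of a path on $k$ vertices in a tournament is a sequence of distinct vertices $x_1x_2\ldots x_k$ such that $x_i\to x_{i+1}$ for every $1\le i\le k-1$ and $x_i\to x_{i+2}$ for every $1\le i\le k-2$ (here $u\to v$ means the edge between $u$ and $v$ is oriented from $u$ to $v$). *)

(* Defs.v *)
From HB Require Import structures.
From mathcomp Require Import all_boot all_order all_algebra.
From mathcomp Require Import reals exp.

Set Implicit Arguments.
Unset Strict Implicit.
Unset Printing Implicit Defensive.

(* [e x y] means that the edge xy is oriented from x to y. *)
Definition is_tournament (T : finType) (e : rel T) : Prop :=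
  irreflexive e /\ (forall x y : T, x != y -> e x y = ~~ e y x).

(* Positions are 0-based. The default value [x0] of [nth] is never returned;
   quantifying over it is harmless, as [s] is empty when [T] is. *)
Definition is_path_square (T : finType) (e : rel T) (s : seq T) : Prop :=
  [/\ uniq s,
      forall (x0 : T) (i : nat),
        i.+1 < size s -> e (nth x0 s i) (nth x0 s i.+1)
    & forall (x0 : T) (i : nat),
        i.+2 < size s -> e (nth x0 s i) (nth x0 s i.+2)].

(* Main.v *)
Require Import Defs.
From HB Require Import structures.
From mathcomp Require Import all_boot all_order all_algebra.
From mathcomp Require Import reals exp.
From mathcomp Require Import zify.
Import Order.TTheory GRing.Theory Num.Theory.
Local Open Scope ring_scope.

(** The bound is in fact linear. List the vertices in a median order, one that
    maximises the number of forward edges: then a vertex [x] dominates at least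
    half of every interval starting right after [x]. Let [I] be an interval of
    72 vertices and [B] a set of four vertices of [I]. Each vertex of [B]
    dominates a third of the next 216 vertices, so by pigeonhole some two of
    them, say [a -> b], have at least 12 common out-neighbours there; four of
    these lie in a common interval of length 72, and one starts again from
    them. Since both [a] and [b] dominate the next pair, the concatenation of
    these pairs is the square of a path. *)

Local Open Scope nat_scope.

Section MedianOrder.

Variables (T : finType) (e : rel T).
Hypothesis eT : is_tournament e.

Fixpoint forward (s : seq T) : nat :=
  if s is x :: t then count (e x) t + forward t else 0.

Lemma forward_cat s t :
  forward (s ++ t) = forward s + forward t + \sum_(x <- s) count (e x) t.
Proof.
elim: s => [|x s IH] /=; first by rewrite big_nil addn0.
by rewrite big_cons IH count_cat; lia.
Qed.

Lemma count_in_out x (q : seq T) :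
  x \notin q -> count (e x) q + \sum_(y <- q) e y x = size q.
Proof.
case: eT => _ tot; elim: q => [|y q IH] /=; first by rewrite big_nil.
rewrite inE negb_or big_cons => /andP[xy /IH].
by rewrite (tot _ _ xy); case: (e y x) => /=; lia.
Qed.

Definition median (s : seq T) : Prop :=
  forall p x q r, s = p ++ x :: q ++ r -> size q <= (count (e x) q).*2.

Lemma median_cat s t : median (s ++ t) -> median t.
Proof.
by move=> med p x q r def_t; apply: (med (s ++ p) x q r); rewrite def_t catA.
Qed.

(* Moving [x] to the end of [q] turns its out-neighbours in [q] into backward
   edges and its in-neighbours in [q] into forward ones. *)
Lemma forward_max_median s :
  uniq s -> (forall t, perm_eq t s -> forward t <= forward s) -> median s.
Proof.
move=> us smax p x q r def_s.
have xq : x \notin q.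
  move: us; rewrite def_s cat_uniq => /and3P[_ _ /=].
  by rewrite mem_cat negb_or -andbA => /andP[].
have /smax : perm_eq (p ++ q ++ x :: r) s.
  by rewrite def_s perm_cat2l (perm_catCA q [:: x] r).
(* Moving [x] does not affect the edges leaving [p], so the two orders differ only in the edges
   between [x] and [q]. *)
have countE y : count (e y) (q ++ x :: r) = count (e y) (x :: q ++ r).
  by rewrite /= !count_cat /=; lia.
have split_in : \sum_(y <- q) count (e y) (x :: r)
    = \sum_(y <- q) e y x + \sum_(y <- q) count (e y) r.
  by rewrite -big_split.
rewrite def_s !forward_cat (eq_bigr _ (fun y _ => countE y)) /=.
rewrite !forward_cat /= split_in count_cat.
by have := count_in_out _ _ xq; lia.
Qed.

Lemma median_order : exists2 s, perm_eq s (enum T) & median s.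
Proof.
have enumP : enum T \in permutations (enum T) by rewrite mem_permutations.
(* The orderings form a finite type, so a maximiser of [forward] exists. *)
pose s0 : seq_sub (permutations (enum T)) := SeqSub enumP.
case: (@arg_maxnP _ s0 xpredT (fun s => forward (ssval s))) => // s _ smax.
have ps : perm_eq (ssval s) (enum T) by rewrite -mem_permutations ssvalP.
exists (ssval s) => //; apply: forward_max_median.
  by rewrite (perm_uniq ps) enum_uniq.
move=> t ts; have tP : t \in permutations (enum T).
  by rewrite mem_permutations (perm_trans ts).
exact: (smax (SeqSub tP)).
Qed.

(** An entry satisfying j of the four predicates adds j on the left and 1 + j(j-1)/2 >= j on the
    right. *)
Lemma count_pairs (a1 a2 a3 a4 : pred T) (s : seq T) :
  count a1 s + count a2 s + count a3 s + count a4 s <=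
  size s + (count (predI a1 a2) s + count (predI a1 a3) s
            + count (predI a1 a4) s + count (predI a2 a3) s
            + count (predI a2 a4) s + count (predI a3 a4) s).
Proof.
elim: s => //= x s.
by case: (a1 x); case: (a2 x); case: (a3 x); case: (a4 x) => /=; lia.
Qed.

(** Four out-degrees of at least |J|/3 sum to 4|J|/3, so by [count_pairs] the six pairwise
    intersections sum to at least |J|/3, and one of them reaches |J|/18. *)
Lemma common_pair (B J : seq T) :
  uniq B -> 4 <= size B ->
  {in B, forall x, size J <= 3 * count (e x) J} ->
  exists a b, [/\ a \in B, b \in B, e a b
                & size J <= 18 * count (predI (e a) (e b)) J].
Proof.
case: eT => _ tot uB sB dB.
(* Common out-neighbourhoods are symmetric, so a pair can be named along its edge. *)
have orient x y : x \in B -> y \in B -> x != y ->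
    size J <= 18 * count (predI (e x) (e y)) J ->
    exists a b, [/\ a \in B, b \in B, e a b
                  & size J <= 18 * count (predI (e a) (e b)) J].
  move=> xB yB xy le_xy; have := tot _ _ xy; case exy: (e x y) => eyx.
    by exists x, y.
  exists y, x; split=> //; first by rewrite -[e y x]negbK -eyx.
  by rewrite (eq_count (a2 := predI (e x) (e y))) // => z /=; rewrite andbC.
case: B uB sB dB orient => [|b1 [|b2 [|b3 [|b4 B]]]] // uB _ dB orient.
have [m1 m2 m3 m4] : [/\ b1 \in [:: b1, b2, b3, b4 & B],
    b2 \in [:: b1, b2, b3, b4 & B], b3 \in [:: b1, b2, b3, b4 & B]
    & b4 \in [:: b1, b2, b3, b4 & B]].
  by rewrite !inE !eqxx !orbT.
move: uB; rewrite /= !inE !negb_or -!andbA.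
case/and5P=> n12 n13 n14 _ /and5P[n23 n24 _ n34 _].
have := count_pairs (e b1) (e b2) (e b3) (e b4) J.
have := dB _ m1; have := dB _ m2; have := dB _ m3; have := dB _ m4.
move=> d4 d3 d2 d1 pairs.
have [?|?] := leqP (size J) (18 * count (predI (e b1) (e b2)) J).
  exact: (orient b1 b2).
have [?|?] := leqP (size J) (18 * count (predI (e b1) (e b3)) J).
  exact: (orient b1 b3).
have [?|?] := leqP (size J) (18 * count (predI (e b1) (e b4)) J).
  exact: (orient b1 b4).
have [?|?] := leqP (size J) (18 * count (predI (e b2) (e b3)) J).
  exact: (orient b2 b3).
have [?|?] := leqP (size J) (18 * count (predI (e b2) (e b4)) J).
  exact: (orient b2 b4).
apply: (orient b3 b4) => //; lia.
Qed.

Lemma dense_third (P : pred T) (L : nat) (J : seq T) :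
  size J = 3 * L ->
  exists J1 I J2, [/\ J = J1 ++ I ++ J2, size I = L
                    & count P J <= 3 * count P I].
Proof.
move=> sJ; set A := take L J; set B := take L (drop L J).
set C := drop L (drop L J).
have defJ : J = A ++ B ++ C by rewrite !cat_take_drop.
have sA : size A = L by rewrite size_takel //; lia.
have sB : size B = L by rewrite size_takel // size_drop; lia.
have sC : size C = L by rewrite !size_drop; lia.
have cJ : count P J = count P A + count P B + count P C.
  by rewrite {1}defJ !count_cat addnA.
have [?|?] := leqP (count P J) (3 * count P A); first by exists [::], A, (B ++ C).
have [?|?] := leqP (count P J) (3 * count P B); first by exists A, B, C.
exists (A ++ B), C, [::]; split=> //; first by rewrite cats0 -catA.
lia.
Qed.

(** Recursive form of the two edge conditions of [is_path_square], suited to prepending vertices. *)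
Fixpoint square_path (s : seq T) : bool :=
  if s is x :: t then all (e x) (take 2 t) && square_path t else true.

Lemma square_pathP s : uniq s -> square_path s -> is_path_square e s.
Proof.
move=> us sq; split=> // x0 i; elim: s i sq {us} => [|x s IH] [|i] //=.
- by case: s {IH} => [|y [|z s]] //= /andP[/andP[]].
- by case/andP=> _ /IH; apply.
- by case: s {IH} => [|y [|z s]] //= /andP[/and3P[]].
- by case/andP=> _ /IH; apply.
Qed.

(** With [q] the part of [I] after [x], the vertex [x] dominates half of [q ++ J], hence at least
    (|J| - |q|)/2 vertices of [J], where |q| <= |J|/3. *)
Lemma median_out_next (I J r : seq T) x :
  median (I ++ J ++ r) -> x \in I -> 3 * size I <= size J ->
  size J <= 3 * count (e x) J.
Proof.
move=> med xI; case/splitPr: xI med => p q med sJ.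
have := med p x (q ++ J) r; rewrite -!catA cat_cons => /(_ erefl).
rewrite size_cat count_cat; have := count_size (e x) q.
by move: sJ; rewrite !size_cat /=; lia.
Qed.

(** In the induction [P] is the common out-neighbourhood of the preceding pair, and the inclusion of
    [l] in [r] keeps the vertices distinct. *)
Lemma square_path_from k (P : pred T) (I r : seq T) :
  median (I ++ r) -> uniq (I ++ r) -> size I = 72 -> 4 <= count P I ->
  k * 216 <= size r ->
  exists a b l, [/\ a \in filter P I, b \in filter P I,
    size l = k.*2, {subset l <= r}
    & uniq [:: a, b & l] && square_path [:: a, b & l]].
Proof.
have irr x : e x x = false by case: eT.
elim: k P I r => [|k IH] P I r med uIr sI cP sr.
  have uB : uniq (filter P I).
    by rewrite filter_uniq //; move: uIr; rewrite cat_uniq => /and3P[].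
  (* With [J] empty the density condition is trivial and only an edge inside [filter P I] is
     extracted. *)
  have [||a [b [aB bB ab _]]] := @common_pair (filter P I) [::] uB => //.
    by rewrite size_filter.
  exists a, b, [::]; split=> //=; rewrite inE ab !andbT.
  by apply: contraTneq ab => ->; rewrite irr.
have [J [r' [defr sJ]]] : exists J r', r = J ++ r' /\ size J = 216.
  by exists (take 216 r), (drop 216 r); rewrite cat_take_drop size_takel //; lia.
have uB : uniq (filter P I).
  by rewrite filter_uniq //; move: uIr; rewrite cat_uniq => /and3P[].
have [||a [b [aB bB ab cab]]] := @common_pair (filter P I) J uB.
- by rewrite size_filter.
- move=> x; rewrite mem_filter => /andP[_ xI].
  by apply: (@median_out_next I J r'); rewrite -?defr // sJ sI.
have [J1 [I' [J2 [defJ sI' cI']]]] :=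
  @dense_third (predI (e a) (e b)) 72 J sJ.
have defr' : r = J1 ++ I' ++ J2 ++ r' by rewrite defr defJ -!catA.
have [||||a' [b' [l [a'B b'B sl lr /andP[ul sql]]]]] :=
  IH (predI (e a) (e b)) I' (J2 ++ r') _ _ sI'.
- by apply: (@median_cat (I ++ J1)); rewrite -catA -defr'; exact: med.
- by move: uIr; rewrite defr' catA cat_uniq => /and3P[].
(* 216/18 = 12 common out-neighbours in [J], so at least 12/3 = 4 in [I']. *)
- by lia.
- by move: sr; rewrite defr !size_cat sJ; lia.
have l'r : {subset [:: a', b' & l] <= r}.
  move=> z; rewrite defr' !inE !mem_cat => /or3P[/eqP->|/eqP->|].
  - by move: a'B; rewrite mem_filter => /andP[_ ->]; rewrite orbT.
  - by move: b'B; rewrite mem_filter => /andP[_ ->]; rewrite orbT.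
  - by move/lr; rewrite mem_cat => ->; rewrite !orbT.
have notin z : z \in filter P I -> z \notin [:: a', b' & l].
  rewrite mem_filter => /andP[_ zI]; apply/negP => /l'r zr.
  move: uIr; rewrite cat_uniq => /and3P[_ /hasPn/(_ _ zr)].
  by rewrite /= zI.
exists a, b, [:: a', b' & l]; split=> //; first by rewrite /= sl.
have /= -> : uniq [:: a, b, a', b' & l].
  rewrite cons_uniq (cons_uniq b) ul (notin b) // !andbT in_cons negb_or.
  rewrite (notin a) // andbT.
  by apply: contraTneq ab => ->; rewrite irr.
(* The edges required are [a] to [b] and [a'], and [b] to [a'] and [b']. *)
move: a'B b'B sql; rewrite !mem_filter /= take0 /=.
by move=> /andP[/andP[-> ->] _] /andP[/andP[_ ->] _] ->; rewrite ab.
Qed.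

Lemma linear_path_square :
  0 < #|T| -> exists2 s, is_path_square e s & #|T| <= 216 * size s.
Proof.
move=> T_gt0; have [s ps med] := median_order.
have us : uniq s by rewrite (perm_uniq ps) enum_uniq.
have ss : #|T| = size s by rewrite (perm_size ps) cardE.
rewrite ss.
have [small|large] := ltnP (size s) 72.
  have /card_gt0P[x _] := T_gt0.
  by exists [:: x]; [apply: square_pathP | apply: leq_trans (ltnW small) _].
have sI : size (take 72 s) = 72 by rewrite size_takel.
(* For k the quotient, the path has 2k + 2 vertices, while [size s] < 72 + 216(k + 1) <= 216(2k +
   2). *)
have [||||a [b [l [_ _ sl _ /andP[ul sql]]]]] :=
  @square_path_from ((size s - 72) %/ 216) predT (take 72 s) (drop 72 s) _ _ sI.
- by rewrite cat_take_drop.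
- by rewrite cat_take_drop.
- by rewrite count_predT sI.
- by rewrite size_drop leq_trunc_div.
exists [:: a, b & l]; first exact: square_pathP.
by rewrite /= sl; move: (size s) => m; lia.
Qed.

End MedianOrder.

Local Open Scope ring_scope.

Theorem theorem1 (R : realType) (eps : R) (heps : 0 < eps) :
  exists2 c : R, 0 < c &
    forall (n : nat) (T : finType) (e : rel T),
      (0 < n)%N -> #|T| = n -> is_tournament e ->
      exists2 s : seq T, is_path_square e s &
        c * (n%:R `^ (1 - eps)) <= (size s)%:R.
Proof.
exists 216%:R^-1; first by rewrite invr_gt0 ltr0n.
move=> n T e n_gt0 cardT eT; subst n.
have [s sq le_s] := @linear_path_square T e eT n_gt0.
exists s => //; rewrite ler_pdivrMl ?ltr0n // -natrM.
(* As n >= 1 and 1 - [eps] <= 1, the power is at most n. *)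
apply: (@le_trans _ _ (#|T|%:R : R)); last by rewrite ler_nat.
rewrite -[leRHS]powRr1 ?ler0n //; apply: ler_powR; first by rewrite ler1n.
by rewrite gerBl ltW.
Qed.
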